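(* Let $f\colon[0,1]\to\mathbb{R}$ be a non-decreasing interval-r.e.\ function which is Lipschitz with constant $c$. Then there is a computable function $g\colon[0,1]\to\mathbb{R}$, Lipschitz with the same constant $c$, such that $f(x)=V(g,[0,x])$ for every $x\in[0,1]$.
   Context: A real $x$ is left-r.e.\ if $\{q\in\mathbb{Q}: q<x\}$ is recursively enumerable. A non-decreasing function $f$ on $[0,1]$ is interval-r.e.\ if $f(0)=0$ and $f(y)-f(x)$ is a left-r.e.\ real uniformly in rationals $0\le x<y\le 1$. A function $g\colon[0,1]\to\mathbb{R}$ is computable if $g(q)$ is a computable real uniformly in rationals $q\in[0,1]$ and $g$ is effectively uniformly continuous (there is a computable $h\colon\mathbb{N}\to\mathbb{N}$ with $|x-y|<2^{-h(n)}\Rightarrow |g(x)-g(y)|<2^{-n}$). The variation is $V(g,[x,y])=\sup\{\sum_{i=1}^{n-1}|g(t_{i+1})-g(t_i)| : x\le t_1\le\dots\le t_n\le y\}$. *)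

(* Defs.v *)
From HB Require Import structures.
From mathcomp Require Import all_boot all_order all_algebra.
From mathcomp Require Import all_classical all_reals all_analysis.
Set Implicit Arguments.
Unset Strict Implicit.
Unset Printing Implicit Defensive.
Import Order.TTheory GRing.Theory Num.Theory.
Import numFieldNormedType.Exports.
Local Open Scope classical_set_scope.
Local Open Scope ring_scope.

(* Total recursive functions: the least class containing zero, successor and
   projections that is closed under composition, primitive recursion, and
   minimization applied where a zero always exists.  The functions built are
   specified by pointwise equations, so the class is extensional. *)
Inductive recursive : forall k : nat, (k.-tuple nat -> nat) -> Prop :=
| recursive_zero k (f : k.-tuple nat -> nat) :
    (forall v, f v = 0%N) -> recursive f
| recursive_succ (f : 1.-tuple nat -> nat) :
    (forall v, f v = (thead v).+1) -> recursive f
| recursive_proj k (i : 'I_k) (f : k.-tuple nat -> nat) :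
    (forall v, f v = tnth v i) -> recursive f
| recursive_comp m k (g : m.-tuple nat -> nat)
    (h : 'I_m -> k.-tuple nat -> nat) (f : k.-tuple nat -> nat) :
    recursive g -> (forall i, recursive (h i)) ->
    (forall v, f v = g [tuple h i v | i < m]) -> recursive f
| recursive_primrec k (g : k.-tuple nat -> nat) (h : k.+2.-tuple nat -> nat)
    (f : k.+1.-tuple nat -> nat) :
    recursive g -> recursive h ->
    (forall v : k.-tuple nat, f [tuple of 0%N :: v] = g v) ->
    (forall n (v : k.-tuple nat), f [tuple of n.+1 :: v] =
       h [tuple of n :: f [tuple of n :: v] :: v]) -> recursive f
| recursive_mu k (h : k.+1.-tuple nat -> nat) (f : k.-tuple nat -> nat) :
    recursive h ->
    (forall v, h [tuple of f v :: v] = 0%N) ->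
    (forall v n, (n < f v)%N -> h [tuple of n :: v] <> 0%N) -> recursive f.

Definition recursively_enumerable k (W : set (k.-tuple nat)) : Prop :=
  exists2 e : k.+1.-tuple nat -> nat, recursive e &
    forall v, W v <-> exists t : nat, e [tuple of t :: v] = 0%N.

(* A surjective numbering of the rationals by prime exponents:
   2 ^ a * 3 ^ b * 5 ^ d codes (a - b) / (d + 1). *)
Definition rat_of_code (n : nat) : rat :=
  ((logn 2 n)%:R - (logn 3 n)%:R) / (logn 5 n).+1%:R.

Definition re_rat k (W : set (k.-tuple rat)) : Prop :=
  recursively_enumerable [set v | W (map_tuple rat_of_code v)].

(* For k = 0 and D the full set, these are the notions of a single left-r.e.
   real and of a single computable real.  W is unconstrained off D. *)
Definition uniformly_left_re (R : realType) k (D : set (k.-tuple rat))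
    (X : k.-tuple rat -> R) : Prop :=
  exists2 W : set (k.+1.-tuple rat), re_rat W &
    forall p, D p ->
      [set q : rat | ratr q < X p] = [set q | W [tuple of q :: p]].

(* The approximation may depend on the code of the parameter; codes of a
   rational can be computably normalized. *)
Definition uniformly_computable (R : realType) k (D : set (k.-tuple rat))
    (X : k.-tuple rat -> R) : Prop :=
  exists2 a : k.+1.-tuple nat -> nat, recursive a &
    forall v, D (map_tuple rat_of_code v) -> forall n : nat,
      `|ratr (rat_of_code (a [tuple of n :: v]))
        - X (map_tuple rat_of_code v)| <= 2 ^- n.

(* Functions on [0, 1] are represented by total functions on R whose values
   outside [0, 1] are never used. *)
Definition interval_re (R : realType) (f : R -> R) : Prop :=
  f 0 = 0 /\
  uniformly_left_re
    [set p : 2.-tuple rat | [/\ 0 <= p`_0, p`_0 < p`_1 & p`_1 <= 1]]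
    (fun p => f (ratr p`_1) - f (ratr p`_0)).

Definition effectively_uniformly_continuous (R : realType) (g : R -> R) : Prop :=
  exists2 h : nat -> nat, recursive (fun v : 1.-tuple nat => h (thead v)) &
    forall n : nat, {in `[0, 1] &, forall x y : R,
      `|x - y| < 2 ^- h n -> `|g x - g y| < 2 ^- n}.

Definition computable_fun (R : realType) (g : R -> R) : Prop :=
  uniformly_computable [set p : 1.-tuple rat | 0 <= p`_0 <= 1]
    (fun p => g (ratr p`_0)) /\
  effectively_uniformly_continuous g.

(* Main.v *)
Require Import Defs.
From HB Require Import structures.
From mathcomp Require Import all_boot all_order all_algebra.
From mathcomp Require Import all_classical all_reals all_analysis.
From mathcomp Require Import zify ring lra.
Import Order.TTheory GRing.Theory Num.Theory.
Import numFieldNormedType.Exports.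
Local Open Scope classical_set_scope.
Local Open Scope ring_scope.

Set Implicit Arguments.
Unset Strict Implicit.

(* Cut [0, 1] into s! equal intervals at level s.  Since the increments of f are
   left-r.e. and f is additive, one can compute lower approximations a(s, k) of
   the increments on the grid whose sums over each interval of level s dominate
   a(s, .) at level s + 1, and whose total tends to f(1).  At level s + 1 let a
   path walk up or down by exactly a(s + 1, k) on the k-th interval, always
   towards the value of the level s path at the end of the current interval of
   level s.  There is enough variation available to reach that value up to one
   step, so the paths converge uniformly at a geometric rate to a computable g
   with |g(y) - g(x)| <= f(y) - f(x), which gives the Lipschitz bound and
   V(g, [x, y]) <= f(y) - f(x).  At the grid points of level s the path is
   within O(1 / (s + 1)!) of g, so the s! errors add up to O(1 / (s + 1)) and
   the variation of g on [0, 1] is at least f(1); additivity of the variation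
   then forces equality on every [0, x]. *)

(** * Closure properties of recursive functions *)

Local Open Scope nat_scope.

(* Arguments are read from an environment [e : nat -> nat], so that a variable
   bound by a sum, an iteration or a search is pushed at index 0 and the
   variables of the context are recovered as [fun i => e i.+1]. *)
Definition envrec k (F : (nat -> nat) -> nat) :=
  recursive (fun v : k.-tuple nat => F (nth 0%N v)).

Lemma recursive_ext k (f g : k.-tuple nat -> nat) :
  f =1 g -> recursive f -> recursive g.
Proof. by move=> fg; rewrite (_ : g = f)//; apply/funext => v. Qed.

Lemma envrec_ext k (F G : (nat -> nat) -> nat) :
  F =1 G -> envrec k F -> envrec k G.
Proof. by move=> FG; apply: recursive_ext => v; exact: FG. Qed.

Lemma envrec_var k i : i < k -> envrec k (fun e => e i).
Proof.
move=> ik; apply: (@recursive_proj _ (Ordinal ik)) => v.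
by rewrite (tnth_nth 0).
Qed.

Lemma recursive_comp_tuple m k (g : m.-tuple nat -> nat)
    (Fs : m.-tuple ((nat -> nat) -> nat)) :
  recursive g -> (forall i, envrec k (tnth Fs i)) ->
  envrec k (fun e => g (map_tuple (fun F => F e) Fs)).
Proof.
move=> rg rFs; apply: (@recursive_comp m k g
  (fun i v => tnth Fs i (nth 0 v)) _ rg rFs) => v.
by congr g; apply: eq_from_tnth => i; rewrite tnth_map tnth_mktuple.
Qed.

(** Composition of [F] with [n] in position 0 and projections elsewhere. It lets a closure property
    be proved for a variable at index 0 and then used for any recursive expression. *)
Lemma envrec_let k (F : nat -> (nat -> nat) -> nat) n :
  envrec k n -> envrec k.+1 (fun e => F (e 0) (fun i => e i.+1)) ->
  envrec k (fun e => F (n e) e).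
Proof.
move=> rn rF.
pose h (i : 'I_k.+1) (v : k.-tuple nat) :=
  nth 0 (n (nth 0 v) :: v) i.
apply: (recursive_comp (h := h) rF) => [[[|i] ik]|v].
- exact: rn.
- by apply: (@envrec_var k i); rewrite -ltnS.
have -> : [tuple h i v | i < k.+1] = [tuple of n (nth 0 v) :: v] by
  apply: eq_from_tnth => i; rewrite tnth_mktuple (tnth_nth 0).
by [].
Qed.

Lemma envrec_iteri k n g (h : (nat -> nat) -> nat -> nat -> nat) :
  envrec k n -> envrec k g ->
  envrec k.+2 (fun e => h (fun i => e i.+2) (e 0) (e 1)) ->
  envrec k (fun e => iteri (n e) (h e) (g e)).
Proof.
move=> rn rg rh.
apply: (@envrec_let _ (fun m e => iteri m (h e) (g e)) _ rn).
by apply: (recursive_primrec rg rh).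
Qed.

Lemma envrec_mu k f (h : nat -> (nat -> nat) -> nat) :
  envrec k.+1 (fun e => h (e 0) (fun i => e i.+1)) ->
  (forall e, h (f e) e = 0) -> (forall e n, n < f e -> h n e <> 0) ->
  envrec k f.
Proof.
by move=> rh h0 hn0; apply: (recursive_mu rh) => [v|v n nf];
  [exact: h0|exact: hn0].
Qed.

Lemma envrec0 k : envrec k (fun=> 0).
Proof. exact: recursive_zero. Qed.

Lemma envrecS k F : envrec k F -> envrec k (fun e => (F e).+1).
Proof.
move=> rF; apply: (@envrec_let _ (fun n _ => n.+1) _ rF).
have r1 : recursive (fun v : 1.-tuple nat => (thead v).+1).
  exact: recursive_succ.
have := @recursive_comp_tuple 1 k.+1 _ [tuple fun e => e 0] r1.
by apply => i; rewrite ord1; exact: envrec_var.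
Qed.

Lemma envrec_cst k n : envrec k (fun=> n).
Proof. by elim: n => [|n /envrecS//]; exact: envrec0. Qed.

Lemma envrec_app2 k (F : nat -> nat -> nat) G H :
  envrec 2 (fun e => F (e 0) (e 1)) ->
  envrec k G -> envrec k H -> envrec k (fun e => F (G e) (H e)).
Proof.
move=> rF rG rH; apply: (@recursive_comp_tuple 2 k _ [tuple G; H] rF).
by case=> [[|[|]]].
Qed.

Lemma envrec_app1 k (F : nat -> nat) G :
  envrec 1 (fun e => F (e 0)) -> envrec k G -> envrec k (fun e => F (G e)).
Proof.
move=> rF rG; apply: (@recursive_comp_tuple 1 k _ [tuple G] rF).
by case=> [[|]].
Qed.

Lemma envrec_app3 k (F : nat -> nat -> nat -> nat) G H K :
  envrec 3 (fun e => F (e 0) (e 1) (e 2)) ->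
  envrec k G -> envrec k H -> envrec k K ->
  envrec k (fun e => F (G e) (H e) (K e)).
Proof.
move=> rF rG rH rK; apply: (@recursive_comp_tuple 3 k _ [tuple G; H; K] rF).
by case=> [[|[|[|]]]].
Qed.

Lemma envrec_pred k F : envrec k F -> envrec k (fun e => (F e).-1).
Proof.
move=> rF.
apply: (@envrec_ext _ (fun e => iteri (F e) (fun i _ => i) 0)) => [e|].
  by case: (F e).
by apply: (@envrec_iteri k F (fun=> 0) (fun _ i _ => i)) => //;
  [exact: envrec0|exact: envrec_var].
Qed.

Lemma envrec_add k F G :
  envrec k F -> envrec k G -> envrec k (fun e => F e + G e).
Proof.
move=> rF rG.
apply: (@envrec_ext _ (fun e => iteri (G e) (fun _ x => x.+1) (F e))) => [e|].
  by elim: (G e) => [|n /= ->]; rewrite ?addn0 ?addnS.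
by apply: (@envrec_iteri k _ _ (fun _ _ x => x.+1)) => //;
  apply: envrecS; exact: envrec_var.
Qed.

Lemma envrec_sub k F G :
  envrec k F -> envrec k G -> envrec k (fun e => F e - G e).
Proof.
move=> rF rG.
apply: (@envrec_ext _ (fun e => iteri (G e) (fun _ x => x.-1) (F e))) => [e|].
  by elim: (G e) => [|n /= ->]; rewrite ?subn0 ?subnS.
by apply: (@envrec_iteri k _ _ (fun _ _ x => x.-1)) => //;
  apply: envrec_pred; exact: envrec_var.
Qed.

(** The condition on [r] sends indices out of range to indices out of range, so that both
    environments read the same default 0 there. *)
Lemma envrec_rename k m (r : nat -> nat) F :
  (forall i, (r i < m) = (i < k)) -> envrec k F ->
  envrec m (fun e => F (fun i => e (r i))).
Proof.
move=> rm rF; pose h (i : 'I_k) (v : m.-tuple nat) := nth 0 v (r i).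
apply: (recursive_comp (h := h) rF) => [i|v].
  by apply: envrec_var; rewrite rm.
congr F; apply/funext => i.
have [ik|ki] := ltnP i k.
  by rewrite -[i in RHS]/(val (Ordinal ik)) -tnth_nth tnth_mktuple.
by rewrite !nth_default// size_tuple// leqNgt rm -leqNgt.
Qed.

Lemma envrec_shift k F :
  envrec k F -> envrec k.+1 (fun e => F (fun i => e i.+1)).
Proof. exact: envrec_rename. Qed.

Lemma envrec_mul k F G :
  envrec k F -> envrec k G -> envrec k (fun e => F e * G e).
Proof.
move=> rF rG.
apply: (@envrec_ext _ (fun e => iteri (G e) (fun _ x => x + F e) 0)) => [e|].
  by elim: (G e) => [|n IH]; [rewrite muln0|rewrite mulnSr -IH].
apply: (@envrec_iteri k _ _ (fun e _ x => x + F e)) => //.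
  exact: envrec0.
by apply: envrec_add; [exact: envrec_var|
  exact: (envrec_shift (envrec_shift rF))].
Qed.

Lemma envrec_exp k F G :
  envrec k F -> envrec k G -> envrec k (fun e => F e ^ G e).
Proof.
move=> rF rG.
apply: (@envrec_ext _ (fun e => iteri (G e) (fun _ x => x * F e) 1)) => [e|].
  by elim: (G e) => [|n IH]; [|rewrite expnSr -IH].
apply: (@envrec_iteri k _ _ (fun e _ x => x * F e)) => //.
  exact: envrec_cst.
by apply: envrec_mul; [exact: envrec_var|
  exact: (envrec_shift (envrec_shift rF))].
Qed.

Lemma envrec_fact k F : envrec k F -> envrec k (fun e => (F e)`!).
Proof.
move=> rF.
apply: (@envrec_ext _ (fun e => iteri (F e) (fun i x => i.+1 * x) 1)) => [e|].
  by elim: (F e) => [|n IH]; [|rewrite factS -IH].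
apply: (@envrec_iteri k _ _ (fun _ i x => i.+1 * x)) => //.
  exact: envrec_cst.
by apply: envrec_mul; [apply: envrecS|]; exact: envrec_var.
Qed.

Lemma envrec_sum k n (F : nat -> (nat -> nat) -> nat) :
  envrec k n -> envrec k.+1 (fun e => F (e 0) (fun i => e i.+1)) ->
  envrec k (fun e => \sum_(i < n e) F i e).
Proof.
move=> rn rF.
apply: (@envrec_ext _ (fun e => iteri (n e) (fun i x => F i e + x) 0)) => [e|].
  by elim: (n e) => [|m /= ->]; rewrite ?big_ord0// big_ord_recr addnC.
apply: (@envrec_iteri k _ _ (fun e i x => F i e + x)) => //.
  exact: envrec0.
apply: envrec_add; last exact: envrec_var.
(* Inside the iteration index 1 holds the accumulator, which the summand must skip. *)
by apply: (envrec_rename (r := fun i => if i is 0 then 0 else i.+1) _ rF);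
  case.
Qed.

Lemma envrec_prod k n (F : nat -> (nat -> nat) -> nat) :
  envrec k n -> envrec k.+1 (fun e => F (e 0) (fun i => e i.+1)) ->
  envrec k (fun e => \prod_(i < n e) F i e).
Proof.
move=> rn rF.
apply: (@envrec_ext _ (fun e => iteri (n e) (fun i x => F i e * x) 1)) => [e|].
  by elim: (n e) => [|m /= ->]; rewrite ?big_ord0// big_ord_recr mulnC.
apply: (@envrec_iteri k _ _ (fun e i x => F i e * x)) => //.
  exact: envrec_cst.
apply: envrec_mul; last exact: envrec_var.
by apply: (envrec_rename (r := fun i => if i is 0 then 0 else i.+1) _ rF);
  case.
Qed.

Lemma envrec_ltn k F G :
  envrec k F -> envrec k G -> envrec k (fun e => (F e < G e : nat)).
Proof.
move=> rF rG; apply: (@envrec_ext _ (fun e => 1 - ((F e).+1 - G e))) => [e|].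
  by case: ltnP; lia.
apply: envrec_sub; first exact: envrec_cst.
by apply: envrec_sub => //; exact: envrecS.
Qed.

Lemma envrec_if k (b : (nat -> nat) -> bool) F G :
  envrec k (fun e => b e : nat) -> envrec k F -> envrec k G ->
  envrec k (fun e => if b e then F e else G e).
Proof.
move=> rb rF rG.
apply: (@envrec_ext _ (fun e => b e * F e + (1 - b e) * G e)) => [e|].
  by case: (b e); lia.
by apply: envrec_add; apply: envrec_mul => //; apply: envrec_sub => //;
  exact: envrec_cst.
Qed.

(** The quotient counts the positive multiples of [d] up to [m]; this makes division a bounded sum
    of tests. *)
Lemma divn_sum m d : 0 < d -> m %/ d = \sum_(i < m) (i.+1 * d < m.+1).
Proof.
move=> d0; rewrite -[LHS]card_ord -sum1_card.
under [RHS]eq_bigr => i _ do rewrite ltnS -leq_divRL//.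
rewrite (big_ord_widen m (fun=> 1)) ?leq_div//.
by rewrite big_mkcond/=; apply: eq_bigr => i _; case: ifP.
Qed.

Lemma envrec_div k F G :
  envrec k F -> envrec k G -> envrec k (fun e => F e %/ G e).
Proof.
move=> rF rG.
apply: (@envrec_ext _ (fun e => if 0 < G e then
  \sum_(i < F e) (i.+1 * G e < (F e).+1) else 0)) => [e|].
  by case: posnP => [->|G0]; rewrite ?divn0 ?divn_sum.
apply: envrec_if; last exact: envrec_cst.
  by apply: envrec_ltn; first exact: envrec_cst.
apply: (@envrec_sum _ _ (fun i e => i.+1 * G e < (F e).+1 : nat)) => //.
apply: envrec_ltn; last by apply: envrecS; exact: (envrec_shift rF).
apply: envrec_mul; last exact: (envrec_shift rG).
by apply: envrecS; exact: envrec_var.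
Qed.

Lemma envrec_logn k p F : prime p ->
  envrec k F -> envrec k (fun e => logn p (F e)).
Proof.
move=> pp; apply: (@envrec_app1 _ (logn p)).
apply: (@envrec_ext _ (fun e =>
   \sum_(i < (e 0).-1) (e 0 < (e 0 %/ p ^ i.+1 * p ^ i.+1).+1))) => [e|].
  have [->|n0] := posnP (e 0); first by rewrite big_ord0 logn0.
  rewrite logn_count_dvd// big_add1 big_mkord.
  by apply: eq_bigr => i _; rewrite ltnS dvdn_eq eqn_leq leq_divM.
apply: (@envrec_sum _ _ (fun i e => (e 0 < (e 0 %/ p ^ i.+1 * p ^ i.+1).+1))).
  by apply: envrec_pred; exact: envrec_var.
have rx : envrec 2 (fun e => p ^ (e 0).+1).
  by apply: envrec_exp; [exact: envrec_cst|apply: envrecS; exact: envrec_var].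
have r1 : envrec 2 (fun e => e 1) by exact: envrec_var.
apply: envrec_ltn => //; apply: envrecS; apply: envrec_mul => //.
exact: envrec_div.
Qed.

(** * The approximating paths *)

Definition bsum n (F : nat -> nat) := \sum_(i < n) F i.
Definition bprod n (F : nat -> nat) := \prod_(i < n) F i.

Lemma envrec_bsum k n (F : (nat -> nat) -> nat -> nat) :
  envrec k n -> envrec k.+1 (fun e => F (fun i => e i.+1) (e 0)) ->
  envrec k (fun e => bsum (n e) (F e)).
Proof. exact: (@envrec_sum _ _ (fun i e => F e i)). Qed.

Lemma envrec_bprod k n (F : (nat -> nat) -> nat -> nat) :
  envrec k n -> envrec k.+1 (fun e => F (fun i => e i.+1) (e 0)) ->
  envrec k (fun e => bprod (n e) (F e)).
Proof. exact: (@envrec_prod _ _ (fun i e => F e i)). Qed.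

Ltac envrec_step :=
  match goal with
  | |- envrec _ (fun e => e _) => exact: envrec_var
  | |- envrec _ (fun=> ?c) => exact: envrec_cst
  | |- envrec _ (fun e => (@?F e).+1) => apply: (@envrecS _ F)
  | |- envrec _ (fun e => (@?F e).-1) => apply: (@envrec_pred _ F)
  | |- envrec _ (fun e => (@?F e)`!) => apply: (@envrec_fact _ F)
  | |- envrec _ (fun e => @?F e + @?G e) => apply: (@envrec_add _ F G)
  | |- envrec _ (fun e => @?F e - @?G e) => apply: (@envrec_sub _ F G)
  | |- envrec _ (fun e => @?F e * @?G e) => apply: (@envrec_mul _ F G)
  | |- envrec _ (fun e => @?F e ^ @?G e) => apply: (@envrec_exp _ F G)
  | |- envrec _ (fun e => @?F e %/ @?G e) => apply: (@envrec_div _ F G)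
  | |- envrec _ (fun e => logn ?p (@?F e)) => apply: (@envrec_logn _ p F)
  | |- envrec _ (fun e => nat_of_bool (@?F e < @?G e)) =>
      apply: (@envrec_ltn _ F G)
  | |- envrec _ (fun e => if _ then _ else _) => apply: envrec_if
  | |- envrec _ (fun e => bsum (@?n e) (@?F e)) =>
      apply: (@envrec_bsum _ n F)
  | |- envrec _ (fun e => bprod (@?n e) (@?F e)) =>
      apply: (@envrec_bprod _ n F)
  | |- envrec _ (fun e => iteri (@?n e) (@?h e) (@?g e)) =>
      apply: (@envrec_iteri _ n g h)
  (* The remaining cases use the functions known from the context to be recursive. *)
  | H : envrec 1 (fun e => ?f (e 0)) |- envrec _ (fun e => ?f (@?a e)) =>
      apply: (@envrec_app1 _ f a H)
  | H : envrec 2 (fun e => ?f (e 0) (e 1))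
    |- envrec _ (fun e => ?f (@?a e) (@?b e)) =>
      apply: (@envrec_app2 _ f a b H)
  | H : envrec 3 (fun e => ?f (e 0) (e 1) (e 2))
    |- envrec _ (fun e => ?f (@?a e) (@?b e) (@?c e)) =>
      apply: (@envrec_app3 _ f a b c H)
  end.
Ltac envrec_tac := repeat (cbv beta; envrec_step); try by [].

(** * Lower counts by stages, and the choice of the stages *)

Definition ratcode m d := 2 ^ m * 5 ^ d.-1.
(** Values at level s are counted in units of 1 / [denom s]. The factor s! matches the number of
    intervals, and 2 ^ s makes a bounded loss of units on each interval negligible in total. *)
Definition denom s := 2 ^ s * s`!.

Lemma envrec_ratcode : envrec 2 (fun e => ratcode (e 0) (e 1)).
Proof. rewrite /ratcode; envrec_tac. Qed.

Lemma envrec_denom : envrec 1 (fun e => denom (e 0)).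
Proof. rewrite /denom; envrec_tac. Qed.

(* Asking for [m + 2] instead of [m + 1] keeps a slack of [1 / denom r] below the
   increment, which pays for the rounding at the finer levels. *)
Definition lowcount (w : 4.-tuple nat -> nat) r i t :=
  bsum t (fun m => 1 - bprod t (fun u =>
    w [tuple u; ratcode m.+2 (denom r); ratcode i r`!; ratcode i.+1 r`!])).

Lemma envrec_lowcount w : recursive w ->
  envrec 3 (fun e => lowcount w (e 0) (e 1) (e 2)).
Proof.
move=> rw; have r2 := envrec_ratcode; have r1 := envrec_denom.
rewrite /lowcount; envrec_tac.
(* Under the two binders, indices 0 to 4 hold [u], [m], [r], [i] and [t]. *)
apply: (envrec_ext _ (@recursive_comp_tuple _ 5 _ [tuple (fun e => e 0);
  (fun e => ratcode (e 1).+2 (denom (e 2)));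
  (fun e => ratcode (e 3) (e 2)`!); (fun e => ratcode (e 3).+1 (e 2)`!)] rw _)).
- by move=> e; congr w; exact: val_inj.
- by case=> [[|[|[|[|]]]]]// ?; rewrite /tnth/=; envrec_tac.
Qed.

(* Subtraction is truncated, so the defect vanishes iff [t < t'] and every
   difference below is nonpositive. *)
Definition defect (B : nat -> nat -> nat -> nat) s t t' :=
  t.+1 - t' + bsum s.+1 (fun r => bsum r`! (fun i =>
    B r i t * denom s.+1 -
    denom r * bsum (s.+1`! %/ r`!)
      (fun j => B s.+1 (i * (s.+1`! %/ r`!) + j) t'))).

Lemma envrec_defect B : envrec 3 (fun e => B (e 0) (e 1) (e 2)) ->
  envrec 3 (fun e => defect B (e 0) (e 1) (e 2)).
Proof. by move=> rB; have r1 := envrec_denom; rewrite /defect; envrec_tac. Qed.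

(** The least suitable next stage is found by minimization, which is total by the second hypothesis;
    iterating this search from stage 0 gives [S]. *)
Lemma stage_exists B : envrec 3 (fun e => B (e 0) (e 1) (e 2)) ->
  (forall s t, exists t', defect B s t t' = 0) ->
  exists2 S : nat -> nat, envrec 1 (fun e => S (e 0)) &
    forall s, defect B s (S s) (S s.+1) = 0.
Proof.
move=> rB ex0.
have ex s t : exists t', defect B s t t' == 0.
  by have [t' /eqP] := ex0 s t; exists t'.
pose nxt s t := ex_minn (ex s t).
have rn : envrec 2 (fun e => nxt (e 0) (e 1)).
  apply: (@envrec_mu _ _ (fun t' e => defect B (e 0) (e 1) t')).
  - by have rd := envrec_defect rB; envrec_tac.
  - by move=> e; rewrite /nxt; case: ex_minnP => m /eqP.
  - move=> e n; rewrite /nxt; case: ex_minnP => m _ min.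
    by rewrite ltnNge => /negP nm d0; apply/nm/min/eqP.
exists (fun s => iteri s nxt 0).
  by apply: (@envrec_iteri _ _ _ (fun _ => nxt)) => //; envrec_tac.
by move=> s; rewrite /= {2}/nxt; case: ex_minnP => m /eqP.
Qed.

(** A list with head a and tail coded by b is coded as 2 ^ a * 3 ^ b, so each [logn 3] drops one
    entry. *)
Definition lookup c i := logn 2 (iteri i (fun _ x => logn 3 x) c).
(* The margin [A s.+1 j] in the test makes the step exact: the subtraction is
   never truncated. *)
Definition walk (A : nat -> nat -> nat) (T : nat -> nat) s k :=
  iteri k (fun j x =>
    if x < 2 * s.+1 * T (j %/ s.+1).+1 + A s.+1 j
    then x + A s.+1 j else x - A s.+1 j) 0.
(* [row A s] codes the list of the values of the path at level [s], the last
   value coming first. *)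
Definition row A s := iteri s (fun s c =>
  iteri s.+1`!.+1 (fun k c' =>
    2 ^ walk A (fun i => lookup c (s`! - i)) s k * 3 ^ c') 0) 0.
Definition path_at A s k := lookup (row A s) (s`! - k).

Lemma envrec_lookup : envrec 2 (fun e => lookup (e 0) (e 1)).
Proof. rewrite /lookup; envrec_tac. Qed.

Lemma envrec_path_at A : envrec 2 (fun e => A (e 0) (e 1)) ->
  envrec 2 (fun e => path_at A (e 0) (e 1)).
Proof.
move=> rA; have rl := envrec_lookup; rewrite /path_at /row /walk; envrec_tac.
Qed.

Lemma lookup_push (F : nat -> nat) n i : i <= n ->
  lookup (iteri n.+1 (fun k c => 2 ^ F k * 3 ^ c) 0) (n - i) = F i.
Proof.
have lx a b : logn 2 (2 ^ a * 3 ^ b) = a.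
  by rewrite lognM ?expn_gt0// pfactorK// lognX muln0 addn0.
have ly a b : logn 3 (2 ^ a * 3 ^ b) = b.
  by rewrite lognM ?expn_gt0// pfactorK// lognX muln0.
have ic m c : iteri m.+1 (fun _ x => logn 3 x) c =
    iteri m (fun _ x => logn 3 x) (logn 3 c).
  by elim: m c => // m IH c; rewrite iteriS IH.
rewrite /lookup; elim: n => [|n IH]; first by case: i => // _; rewrite /= lx.
rewrite leq_eqVlt => /predU1P[->|]; first by rewrite subnn/= lx.
rewrite ltnS => iN; rewrite subSn// ic iteriS ly; exact: IH.
Qed.

Lemma path_at0 A k : path_at A 0 k = 0.
Proof.
rewrite /path_at /lookup /row.
rewrite (_ : iteri _ (fun _ x => logn 3 x) _ = 0) ?logn0//.
by elim: (_ - k) => //= n ->; rewrite logn0.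
Qed.

Lemma path_at_walk A s k : k <= s.+1`! ->
  path_at A s.+1 k = walk A (path_at A s) s k.
Proof. by move=> ks; rewrite /path_at [row A s.+1]iteriS lookup_push. Qed.

Lemma path_step A s k : k < s.+1`! ->
  path_at A s.+1 k.+1 =
  if path_at A s.+1 k < 2 * s.+1 * path_at A s (k %/ s.+1).+1 + A s.+1 k
  then path_at A s.+1 k + A s.+1 k else path_at A s.+1 k - A s.+1 k.
Proof. by move=> ks; rewrite !path_at_walk// ltnW. Qed.

Lemma path_step_exact A s k : k < s.+1`! ->
  path_at A s.+1 k.+1 = path_at A s.+1 k + A s.+1 k \/
  path_at A s.+1 k = path_at A s.+1 k.+1 + A s.+1 k.
Proof.
move=> ks; rewrite (path_step A ks).
by case: ltnP => h; [left|right; rewrite subnK// (leq_trans _ h)// leq_addl].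
Qed.

Lemma path_step_le A s k : k < s`! ->
  path_at A s k.+1 <= path_at A s k + A s k /\
  path_at A s k <= path_at A s k.+1 + A s k.
Proof.
case: s => [|s] ks; first by rewrite !path_at0.
by have [->|->] := path_step_exact A ks; split; lia.
Qed.

(* Every step keeps the distance to the target below the error [2 h] plus what
   is still to be walked in the block; the blocks are long enough to follow the
   step of the coarser path. *)
Lemma path_track A s h i :
  (forall k, k < s.+1`! -> A s.+1 k <= h) ->
  (forall i, i < s`! ->
    2 * s.+1 * A s i <= \sum_(j < s.+1) A s.+1 (i * s.+1 + j)) ->
  i <= s`! ->
  path_at A s.+1 (i * s.+1) <= 2 * s.+1 * path_at A s i + 2 * h /\
  2 * s.+1 * path_at A s i <= path_at A s.+1 (i * s.+1) + 2 * h.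
Proof.
move=> Ah Asum; elim: i => [|i IH] is_.
  by rewrite mul0n path_at_walk// /walk/=; case: s {Ah Asum is_} => [|s];
    rewrite ?path_at0 ?path_at_walk /walk//= !muln0.
have {IH}[I1 I2] := IH (ltnW is_).
pose rest j := \sum_(j <= l < s.+1) A s.+1 (i * s.+1 + l).
pose T := 2 * s.+1 * path_at A s i.+1.
have [P1 P2] := path_step_le A is_.
have inv j : j <= s.+1 ->
    path_at A s.+1 (i * s.+1 + j) <= T + 2 * h + rest j /\
    T <= path_at A s.+1 (i * s.+1 + j) + 2 * h + rest j.
  elim: j => [_|j IH js].
    (* At the start of a block the walk is within [2 * h] of the previous target, and the target
       moves by at most [2 * s.+1 * A s i], which [rest 0] covers. *)
    have := Asum _ is_.
    rewrite -(big_mkord xpredT (fun j => A s.+1 (i * s.+1 + j))).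
    rewrite -/(rest 0) addn0 => R0; rewrite /T.
    have Q1 := leq_mul (leqnn (2 * s.+1)) P1.
    have Q2 := leq_mul (leqnn (2 * s.+1)) P2.
    by rewrite !mulnDr in Q1 Q2; split; lia.
  have kN : i * s.+1 + j < s.+1`!.
    rewrite factS (mulnC s.+1) (@leq_trans (i.+1 * s.+1))//.
      by rewrite mulSnr ltn_add2l.
    by rewrite leq_mul2r is_ orbT.
  have := path_step A kN; rewrite addnS divnMDl// divn_small// addn0 -/T.
  have := IH (ltnW js); rewrite /rest big_ltn// -/(rest j.+1).
  have := Ah _ kN.
  move: (path_at _ _ _) (A _ _) (rest _) => x a r ah [J1 J2] ->.
  (* An up step starts below [T + a] and ends below [T + 2 * h], as [a] is at most [h]; a down step
     ends at or above [T]. The opposite inequality survives because the step of size [a] makes up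
     for what [rest] loses. *)
  by case: ltnP => ?; split; lia.
have := inv s.+1 (leqnn _); rewrite /rest big_geq// !addn0 -mulSnr.
by rewrite /T.
Qed.

Local Open Scope ring_scope.

(** * Lower approximations of the increments *)

Definition grid (R : realType) s k : R := k%:R / s`!%:R.

Definition increment (R : realType) (f : R -> R) s k :=
  f (grid R s k.+1) - f (grid R s k).

Lemma rat_of_ratcode m d : (0 < d)%N -> rat_of_code (ratcode m d) = m%:R / d%:R.
Proof.
move=> d0; rewrite /rat_of_code /ratcode.
have l2 : logn 2 (2 ^ m * 5 ^ d.-1) = m.
  by rewrite lognM ?expn_gt0// pfactorK// lognX muln0 addn0.
have l3 : logn 3 (2 ^ m * 5 ^ d.-1) = 0%N.
  by rewrite lognM ?expn_gt0// !lognX !muln0.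
have l5 : logn 5 (2 ^ m * 5 ^ d.-1) = d.-1.
  by rewrite lognM ?expn_gt0// pfactorK// lognX muln0.
by rewrite l2 l3 l5 subr0 prednK.
Qed.

Lemma grid_ge0 (R : realType) s k : 0 <= grid R s k.
Proof. by rewrite divr_ge0. Qed.

Lemma grid_le (R : realType) s k l : (k <= l)%N -> grid R s k <= grid R s l.
Proof. by move=> kl; rewrite ler_pM2r ?ler_nat// invr_gt0 ltr0n fact_gt0. Qed.

Lemma grid_top (R : realType) s : grid R s s`! = 1.
Proof. by rewrite /grid divff// pnatr_eq0 -lt0n fact_gt0. Qed.

Lemma grid_in01 (R : realType) s k : (k <= s`!)%N -> grid R s k \in `[0, 1].
Proof. by move=> ks; rewrite in_itv/= grid_ge0 -(grid_top R s) grid_le. Qed.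

Lemma grid_refine (R : realType) r s q k :
  (s`! = q * r`!)%N -> grid R s (k * q) = grid R r k.
Proof.
move=> E; rewrite /grid E !natrM.
have r0 : (r`!%:R : R) != 0 by rewrite pnatr_eq0 -lt0n fact_gt0.
have q0 : (q%:R : R) != 0.
  rewrite pnatr_eq0 -lt0n; have := fact_gt0 s; rewrite E muln_gt0.
  by case/andP.
by field; rewrite r0 q0.
Qed.

Lemma increment_refine (R : realType) (f : R -> R) r s q i :
  (s`! = q * r`!)%N -> \sum_(j < q) increment f s (i * q + j) = increment f r i.
Proof.
move=> E; rewrite -(big_mkord xpredT (fun j => increment f s (i * q + j))).
rewrite /increment.
under eq_bigr do rewrite -addnS.
rewrite (telescope_sumr (fun j => f (grid R s (i * q + j))))//.
by rewrite addn0 -mulSnr !(grid_refine R _ E).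
Qed.

Lemma increment_total (R : realType) (f : R -> R) s :
  f 0 = 0 -> \sum_(i < s`!) increment f s i = f 1.
Proof.
move=> f0; rewrite -(big_mkord xpredT (increment f s)) /increment.
rewrite (telescope_sumr (fun j => f (grid R s j)))//.
by rewrite grid_top /grid mul0r f0 subr0.
Qed.

(** The endpoints and the tested fraction have explicit codes, so the uniform enumeration of the
    left cuts becomes a search for a zero of one recursive function. *)
Lemma increment_witness (R : realType) (f : R -> R) : interval_re f ->
  exists2 w : 4.-tuple nat -> nat, recursive w &
    forall r i m d, (i < r`!)%N -> (0 < d)%N ->
      m%:R < d%:R * increment f r i <->
      exists u, w [tuple u; ratcode m d; ratcode i r`!; ratcode i.+1 r`!] = 0%N.
Proof.
case=> _ [W [w rw ww] WX]; exists w => // r i m d ir d0.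
have rr0 := fact_gt0 r.
pose x k := rat_of_code (ratcode k r`!).
have xE k : x k = k%:R / r`!%:R by rewrite /x rat_of_ratcode.
have ratx k : ratr (x k) = grid R r k by rewrite xE fmorph_div/= !ratr_nat.
have rp : 0 < (r`!%:R : rat) by rewrite ltr0n.
pose p := [tuple x i; x i.+1].
have Dp : [/\ 0 <= p`_0, p`_0 < p`_1 & p`_1 <= 1].
  rewrite /= !xE; split; first by rewrite divr_ge0.
    by rewrite ltr_pM2r ?invr_gt0// ltr_nat.
  by rewrite ler_pdivrMr// mul1r ler_nat.
have := WX p Dp; rewrite /= !ratx -/(increment f r i).
pose y := rat_of_code (ratcode m d).
move=> /seteqP [/(_ y)/= H1 /(_ y)/= H2].
have E : (m%:R < d%:R * increment f r i) = (ratr y < increment f r i).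
  rewrite /y rat_of_ratcode// fmorph_div/= !ratr_nat ltr_pdivrMr ?ltr0n//.
  by rewrite mulrC.
pose v := [tuple ratcode m d; ratcode i r`!; ratcode i.+1 r`!].
have Wv : W (map_tuple rat_of_code v) <->
    exists u, w [tuple of u :: v] = 0%N by exact: ww.
have vE : map_tuple rat_of_code v = [tuple of y :: p] by exact: val_inj.
have -> : (m%:R < d%:R * increment f r i) <-> W (map_tuple rat_of_code v).
  by rewrite vE E; split=> [/H1|/H2].
rewrite Wv.
split=> -[u wu]; exists u; apply: etrans wu; congr w; exact: val_inj.
Qed.

(** * Counting and finite conjunctions *)

Local Open Scope nat_scope.

(** Take the last [m] below [t] with [F m] positive. The indices counted need not form an initial
    segment, yet their number is at most [m + 1]. *)
Lemma bsum_last F t : (forall m, F m <= 1) -> 0 < bsum t F ->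
  exists2 m, 0 < F m & bsum t F <= m.+1.
Proof.
move=> F1; elim: t => [|t IH]; first by rewrite /bsum big_ord0.
rewrite /bsum big_ord_recr/= -/(bsum t F); have [Ft|Ft] := posnP (F t).
  by rewrite Ft addn0.
move=> _; exists t => //; rewrite -addn1 leq_add//.
by rewrite -[leqRHS]card_ord -sum1_card leq_sum.
Qed.

Lemma bsum_ge F n t : n <= t -> (forall m, m < n -> 0 < F m) -> n <= bsum t F.
Proof.
move=> /subnKC <- F0; rewrite /bsum big_split_ord/= -[leqLHS]addn0 leq_add//.
by rewrite -[leqLHS]card_ord -sum1_card leq_sum// => i _; exact: F0.
Qed.

Lemma eventually_forall n (P : nat -> nat -> Prop) :
  (forall k, k < n -> exists t0, forall t, t0 <= t -> P k t) ->
  exists t0, forall t, t0 <= t -> forall k, k < n -> P k t.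
Proof.
elim: n => [|n IH] H; first by exists 0.
have [|t1 H1] := IH; first by move=> k kn; apply: H; rewrite ltnS ltnW.
have [t2 H2] := H n (ltnSn n).
exists (maxn t1 t2) => t; rewrite geq_max => /andP[t1t t2t] k.
by rewrite ltnS leq_eqVlt => /predU1P[->|]; [exact: H2|exact: H1].
Qed.

Lemma sum_blocks (F : nat -> nat) n q :
  \sum_(k < n * q) F k = \sum_(i < n) \sum_(j < q) F (i * q + j).
Proof.
elim: n => [|n IH]; first by rewrite !big_ord0.
by rewrite mulSnr big_split_ord/= IH big_ord_recr.
Qed.

Local Open Scope ring_scope.

(** The last index [m] confirmed by stage [t] bounds the count by [m + 1], while its test certifies
    the numerator [m + 2]; this is the slack of one unit. *)
Lemma lowcount_lt (R : realType) (f : R -> R) w r i t :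
  (forall m d, (0 < d)%N -> m%:R < d%:R * increment f r i <->
    exists u,
      w [tuple u; ratcode m d; ratcode i r`!; ratcode i.+1 r`!] = 0%N) ->
  (0 < lowcount w r i t)%N ->
  (lowcount w r i t).+1%:R < (denom r)%:R * increment f r i.
Proof.
move=> wP /bsum_last[m|m]; first exact: leq_subr.
rewrite subn_gt0 ltnS leqn0 => /eqP b0 cm.
apply: (@le_lt_trans _ _ m.+2%:R); first by rewrite ler_nat.
apply/wP; first by rewrite muln_gt0 expn_gt0 fact_gt0.
apply: contrapT => nu; suff : (0 < 0)%N by [].
rewrite -{2}b0; apply: prodn_gt0 => u; rewrite lt0n; apply/eqP => wu.
by apply: nu; exists u.
Qed.

(** For the least [n] with [x <= n + 2], either [n] is 0 or [n + 1 < x]. In the latter case the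
    tests of all [m < n] succeed eventually, since [m + 2 <= n + 1]. *)
Lemma lowcount_ge (R : realType) (f : R -> R) w r i :
  (forall m d, (0 < d)%N -> m%:R < d%:R * increment f r i <->
    exists u,
      w [tuple u; ratcode m d; ratcode i r`!; ratcode i.+1 r`!] = 0%N) ->
  exists t0, forall t, (t0 <= t)%N ->
    (denom r)%:R * increment f r i <= (lowcount w r i t + 2)%:R.
Proof.
move=> wP; set x := _ * _.
have D0 : (0 < denom r)%N by rewrite muln_gt0 expn_gt0 fact_gt0.
have /ex_minnP[n xn nmin] : exists n, x <= (n + 2)%:R.
  exists (Num.bound `|x|); apply: (le_trans (ler_norm x)).
  apply: (le_trans (ltW (archi_boundP (normr_ge0 x)))).
  by rewrite ler_nat leq_addr.
have [n0|n0] := posnP n.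
  by exists 0%N => t _; rewrite (le_trans xn)// ler_nat n0 leq_add2r.
have nx : n.+1%:R < x.
  rewrite ltNge; apply/negP => xn1; have := nmin n.-1%N.
  by rewrite addn2 prednK// => /(_ xn1); rewrite leqNgt prednK// leqnn.
have [t1 H1] : exists t0, forall t, (t0 <= t)%N -> forall m, (m < n)%N ->
    (0 < 1 - bprod t (fun u => w [tuple u; ratcode m.+2 (denom r);
       ratcode i r`!; ratcode i.+1 r`!]))%N.
  apply: eventually_forall => m mn.
  have [|u wu] := (wP m.+2%N (denom r) D0).1.
    by apply: le_lt_trans nx; rewrite ler_nat.
  exists u.+1%N => t ut; rewrite /bprod (bigD1 (Ordinal ut))//= wu mul0n.
  by [].
exists (maxn n t1) => t; rewrite geq_max => /andP[nt t1t].
rewrite (le_trans xn)// ler_nat leq_add2r; apply: bsum_ge => //.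
exact: H1.
Qed.

Lemma denomS s : denom s.+1 = (2 * s.+1 * denom s)%N.
Proof. by rewrite /denom expnS factS; lia. Qed.

Lemma fact_divK r s : (r <= s)%N -> (s`! %/ r`! * r`! = s`!)%N.
Proof.
move=> rs; rewrite divnK// -(subnKC rs).
by rewrite -(bin_fact (leq_addr (s - r) r)) mulnCA dvdn_mulr.
Qed.

(* The variation of the approximating paths at level [s] is [A s k / denom s]
   over the [k]-th interval of mesh [1 / s!]. *)
Lemma computable_increments (R : realType) (f : R -> R) : interval_re f ->
  exists A : nat -> nat -> nat,
  [/\ envrec 2 (fun e => A (e 0%N) (e 1%N)),
      forall s k, {in `[0, 1] &, nondecreasing_fun f} -> (k < s`!)%N ->
        (A s k)%:R <= (denom s)%:R * increment f s k,
      forall s i, (i < s`!)%N ->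
        (2 * s.+1 * A s i <= \sum_(j < s.+1) A s.+1 (i * s.+1 + j))%N &
      forall e : R, 0 < e -> exists s0, forall s, (s0 <= s)%N ->
        f 1 - e <= (\sum_(k < s`!) A s k)%:R / (denom s)%:R].
Proof.
move=> fre; have f0 := fre.1.
have [w rw wP] := increment_witness fre.
pose B := lowcount w; have rB := envrec_lowcount rw.
have Dgt0 s : (0 < denom s)%N by rewrite muln_gt0 expn_gt0 fact_gt0.
have DR s : 0 < (denom s)%:R :> R by rewrite ltr0n.
have Blt r i t : (i < r`!)%N -> (0 < B r i t)%N ->
    (B r i t).+1%:R < (denom r)%:R * increment f r i.
  by move=> ir; apply: lowcount_lt => m d; exact: wP.
have Bge r i : (i < r`!)%N -> exists t0, forall t, (t0 <= t)%N ->
    (denom r)%:R * increment f r i <= (B r i t + 2)%:R.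
  by move=> ir; apply: lowcount_ge => m d; exact: wP.
have Bge_all r : exists t0, forall t, (t0 <= t)%N -> forall i, (i < r`!)%N ->
    (denom r)%:R * increment f r i <= (B r i t + 2)%:R.
  by apply: eventually_forall => i; exact: Bge.
(* At a late stage each count at level [s.+1] is within 2 units of its increment. The loss [2 * q]
   over [q] subintervals is paid by the slack of one unit at level [r]. *)
have ex s t : exists t', defect B s t t' = 0%N.
  have [t0 H0] := Bge_all s.+1%N.
  exists (maxn t.+1 t0)%N; set t' := maxn _ _.
  rewrite /defect; have -> : (t.+1 - t' = 0)%N.
    by apply/eqP; rewrite subn_eq0 leq_maxl.
  rewrite add0n /bsum big1// => -[r /= rs] _; rewrite big1// => -[i /= ir] _.
  apply/eqP; rewrite subn_eq0; set q := (_ %/ _)%N.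
  have qE : (s.+1`! = q * r`!)%N by rewrite fact_divK// ltnW.
  have [->//|Bpos] := posnP (B r i t).
  rewrite -(ler_nat R) (natrM _ (B r i t)) (natrM _ (denom r)) natr_sum.
  have := Blt r i t ir Bpos; rewrite -(increment_refine f i qE) => HB.
  have : (denom s.+1)%:R * \sum_(j < q) increment f s.+1 (i * q + j) <=
      \sum_(j < q) (B s.+1%N (i * q + j)%N t')%:R + 2 * q%:R :> R.
    rewrite mulr_sumr (_ : 2 * q%:R = \sum_(j < q) 2); last first.
      by rewrite sumr_const card_ord mulr_natr.
    rewrite -big_split/=; apply: ler_sum => -[j /= jq] _; rewrite -natrD.
    apply: H0; first exact: leq_maxr.
    rewrite qE (@leq_trans (i.+1 * q)%N)//; first by rewrite mulSnr ltn_add2l.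
    by rewrite mulnC leq_mul.
  set S' := \sum_(j < q) increment _ _ _ in HB *.
  set S := \sum_(j < q) _ => HS.
  (* One unit at level [r] is worth at least [2 * q] units at level [s.+1], because [r <= s] leaves
     a spare factor 2 in the powers of 2. *)
  have Dq : (2 * q * denom r <= denom s.+1)%N.
    rewrite /denom qE -mulnA (mulnCA q) !mulnA -expnS leq_mul2r.
    by rewrite leq_mul2r leq_exp2l// rs !orbT.
  move: Dq; rewrite -(ler_nat R) (natrM _ (2 * q)) (natrM _ 2) => Dq.
  rewrite -natr1 in HB; move: HB HS Dq (ltW (DR r)) (ltW (DR s.+1%N)).
  move: (denom r)%:R (denom s.+1)%:R S' S (B r i t)%:R q%:R.
  move=> x y S1 S2 b u HB HS Hxy x0 y0.
  by have := ler_wpM2l x0 HS; have := ler_wpM2l y0 (ltW HB); lra.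
have [T rT T0] := stage_exists rB ex.
have TS s : (T s < T s.+1)%N.
  by have /eqP := T0 s; rewrite /defect addn_eq0 subn_eq0 => /andP[].
have Ts s : (s <= T s)%N by elim: s => // s IH; exact: leq_ltn_trans (TS s).
(* The case [r = s] gives the domination between consecutive levels; a fixed [r] with growing [s]
   gives the convergence of the totals. *)
have key s r i : (r <= s)%N -> (i < r`!)%N ->
   (B r i (T s) * denom s.+1 <= denom r * \sum_(j < s.+1`! %/ r`!)
      B s.+1 (i * (s.+1`! %/ r`!) + j)%N (T s.+1))%N.
  rewrite -ltnS => rs ir.
  have /eqP := T0 s; rewrite /defect addn_eq0 /bsum => /andP[_].
  rewrite sum_nat_eq0 => /forallP/(_ (Ordinal rs))/=.
  by rewrite sum_nat_eq0 => /forallP/(_ (Ordinal ir))/=; rewrite subn_eq0.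
exists (fun s k => B s k (T s)); split.
- by apply: (envrec_app3 rB); [exact: envrec_var|exact: envrec_var|
    apply: (envrec_app1 rT); exact: envrec_var].
- move=> s k fnd ks; have [->|Bpos] := posnP (B s k (T s)).
    rewrite mulr_ge0// subr_ge0 fnd ?grid_le ?grid_in01//; exact: ltnW.
  by apply: le_trans (ltW (Blt _ _ _ ks Bpos)); rewrite ler_nat.
- move=> s i si; have := key s s i (leqnn s) si.
  rewrite factS mulnK ?fact_gt0// denomS mulnC (mulnC _ (denom s)) -mulnA.
  by rewrite leq_pmul2l.
(* At level [r] each of the r! counts eventually misses at most 2 units of 1 / [denom r], which
   makes 2 / 2 ^ r in total. *)
- move=> e e0; have [r re] : exists r, 2 / 2 ^+ r <= e.
    exists (Num.bound (2 / e)).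
    rewrite ler_pdivrMr ?exprn_gt0// mulrC -ler_pdivrMr//.
    have e2 : 0 <= 2 / e by rewrite divr_ge0// ltW.
    rewrite (le_trans (ltW (archi_boundP e2)))// -natrX ler_nat ltnW//.
    exact: ltn_expl.
  have [t0 H0] := Bge_all r.
  (* The shift by one is there because level [s.+1] dominates the counts taken at stage [T s], and
     [T s] is at least [s]. *)
  exists (maxn r t0).+1%N => -[//|s]; rewrite ltnS geq_max => /andP[rs t0s].
  rewrite ler_pdivlMr// mulrC -(ler_pM2l (DR r)) -natrM.
  set q := (s.+1`! %/ r`!)%N.
  have qE : (s.+1`! = r`! * q)%N by rewrite mulnC fact_divK// ltnW.
  have -> : (\sum_(k < s.+1`!) B s.+1 k (T s.+1) =
      \sum_(i < r`!) \sum_(j < q) B s.+1 (i * q + j)%N (T s.+1))%N.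
    by rewrite qE (sum_blocks (fun k => B s.+1%N k (T s.+1%N))).
  rewrite big_distrr/=.
  have kk : (\sum_(i < r`!) B r i (T s) * denom s.+1 <= 
    \sum_(i < r`!) denom r * \sum_(j < q) B s.+1 (i * q + j)%N (T s.+1))%N.
    by apply: leq_sum => i _; exact: key.
  move: kk; rewrite -(ler_nat R); apply: le_trans.
  rewrite -big_distrl/= natrM mulrCA mulrC ler_pM2r// natr_sum.
  rewrite -(increment_total r f0) mulrBr mulr_sumr.
  have : \sum_(i < r`!) (denom r)%:R * increment f r i <=
      \sum_(i < r`!) ((B r i (T s))%:R + 2).
    apply: ler_sum => i _; rewrite -natrD; apply: H0 => //.
    exact: leq_trans (Ts s).
  rewrite big_split/= sumr_const card_ord.
  suff : 2 *+ r`! <= (denom r)%:R * e by lra.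
  rewrite /denom natrM natrX -mulr_natl mulrC.
  rewrite mulrAC ler_pM2r ?ltr0n ?fact_gt0//.
  by move: re; rewrite ler_pdivrMr ?exprn_gt0// mulrC.
Qed.

(** * The limit function *)

Section GeometricConvergence.
Context {R : realType}.
Implicit Types (a : nat -> R) (b : R).

Lemma le_of_geometric (x y b : R) : (forall n, x <= y + b / 2 ^+ n) -> x <= y.
Proof.
move=> xy; rewrite leNgt; apply/negP => yx.
have d0 : 0 < x - y by rewrite subr_gt0.
have b0 : 0 <= `|b| / (x - y) by rewrite divr_ge0// ltW.
set n := Num.bound (`|b| / (x - y)).
have : `|b| / (x - y) < 2 ^+ n.
  rewrite (lt_le_trans (archi_boundP b0))// -natrX ler_nat ltnW//.
  exact: ltn_expl.
rewrite ltr_pdivrMr// mulrC -ltr_pdivrMr ?exprn_gt0// => bn.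
have := xy n; have : b / 2 ^+ n <= `|b| / 2 ^+ n.
  by rewrite ler_pM2r ?invr_gt0 ?exprn_gt0// ler_norm.
lra.
Qed.

Lemma ler_dist_nat (x y e : nat) : (x <= y + e)%N -> (y <= x + e)%N ->
  `|x%:R - y%:R| <= e%:R :> R.
Proof. by move=> h1 h2; rewrite ler_distl lerBlDr -!natrD !ler_nat h1 h2. Qed.

Lemma geometric_dist a b : (forall n, `|a n.+1 - a n| <= b / 2 ^+ n) ->
  forall n m, `|a (n + m)%N - a n| <= 2 * b / 2 ^+ n.
Proof.
move=> ab n m.
have b0 : 0 <= b.
  by have := le_trans (normr_ge0 _) (ab 0%N); rewrite expr0 divr1.
(* Subtracting the tail of the geometric series makes the bound inductive in [m]. *)
suff H : `|a (n + m)%N - a n| <= 2 * b / 2 ^+ n - 2 * b / 2 ^+ (n + m).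
  by rewrite (le_trans H)// gerBl divr_ge0 ?mulr_ge0// exprn_ge0.
elim: m => [|m IH]; first by rewrite addn0 !subrr normr0.
have := ler_distD (a (n + m)%N) (a (n + m.+1)%N) (a n).
have := ab (n + m)%N; rewrite addnS.
have -> : 2 * b / 2 ^+ (n + m).+1 = b / 2 ^+ (n + m).
  by rewrite exprS; field; rewrite expf_neq0// pnatr_eq0.
have E : 2 * b / 2 ^+ (n + m) = b / 2 ^+ (n + m) + b / 2 ^+ (n + m) by ring.
rewrite E in IH.
by move: IH; lra.
Qed.

(** The intervals of radius [2 * b / 2 ^+ n] around [a n] meet pairwise, so the supremum of their
    left ends lies in all of them. *)
Lemma geometric_limit a b : (forall n, `|a n.+1 - a n| <= b / 2 ^+ n) ->
  exists l, forall n, `|a n - l| <= 2 * b / 2 ^+ n.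
Proof.
move=> ab; have dist := geometric_dist ab.
pose S := [set a n - 2 * b / 2 ^+ n | n in [set: nat]].
have Sle m n : a m - 2 * b / 2 ^+ m <= a n + 2 * b / 2 ^+ n.
  have b0 k : 0 <= b / 2 ^+ k by apply: le_trans (ab k).
  have [mn|/ltnW nm] := leqP m n.
    have := dist m (n - m)%N; rewrite subnKC// ler_norml => /andP[h _].
    by have := b0 n; lra.
  have := dist n (m - n)%N; rewrite subnKC// ler_norml => /andP[_ h].
  by have := b0 m; lra.
exists (sup S) => n; rewrite ler_distl; apply/andP; split.
  by rewrite lerBlDr; apply: ge_sup;
    [exists (a 0%N - 2 * b / 2 ^+ 0), 0%N|move=> _ [m _ <-]].
rewrite -lerBlDr; apply: ub_le_sup; last by exists n.
by exists (a 0%N + 2 * b / 2 ^+ 0) => _ [m _ <-].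
Qed.

(** The rate [d] serves only to identify the limit and does not enter the bound. A coarse rate can
    thus be traded for a much smaller [b]. *)
Lemma limit_dist a b d l : (forall n, `|a n.+1 - a n| <= b / 2 ^+ n) ->
  (forall n, `|a n - l| <= d / 2 ^+ n) -> `|a 0%N - l| <= 2 * b.
Proof.
move=> ab al; apply: (@le_of_geometric _ _ d) => n.
have := geometric_dist ab 0 n; rewrite add0n expr0 divr1 => h.
have := ler_distD (a n) (a 0%N) l; have := al n; rewrite (distrC (a 0%N) (a n)).
by lra.
Qed.

End GeometricConvergence.

Section LimitFunction.
Context {R : realType}.
Variables (f : R -> R) (A : nat -> nat -> nat) (M : nat).
Hypothesis f0 : f 0 = 0.
Hypothesis f_nd : {in `[0, 1] &, nondecreasing_fun f}.
Hypothesis f_lip :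
  {in `[0, 1] &, forall x y, x <= y -> f y - f x <= M%:R * (y - x)}.
Hypothesis A_le : forall s k, (k < s`!)%N ->
  (A s k)%:R <= (denom s)%:R * increment f s k.
Hypothesis A_sum : forall s i, (i < s`!)%N ->
  (2 * s.+1 * A s i <= \sum_(j < s.+1) A s.+1 (i * s.+1 + j))%N.
Hypothesis A_lim : forall e : R, 0 < e -> exists s0, forall s, (s0 <= s)%N ->
  f 1 - e <= (\sum_(k < s`!) A s k)%:R / (denom s)%:R.

Definition height s k : R := (path_at A s k)%:R / (denom s)%:R.

Let fact_pos s : 0 < s`!%:R :> R. Proof. by rewrite ltr0n fact_gt0. Qed.

Let denom_pos s : 0 < (denom s)%:R :> R.
Proof. by rewrite ltr0n muln_gt0 expn_gt0 fact_gt0. Qed.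

Lemma exp_le_fact s : 2 ^+ s <= 2 * s`!%:R :> R.
Proof.
rewrite -natrX -natrM ler_nat; elim: s => // -[//|s] IH.
by rewrite expnS factS mulnCA leq_mul.
Qed.

Lemma gridS s k : grid R s k.+1 - grid R s k = s`!%:R^-1.
Proof. by rewrite /grid -mulrBl -natrB// subSnn mul1r. Qed.

(** On a mesh of 1 / s! the Lipschitz bound cancels the factorial in [denom s]. This is the bound
    [h] fed to [path_track]. *)
Lemma A_bound s k : (k < s`!)%N -> (A s k <= M * 2 ^ s)%N.
Proof.
move=> ks; rewrite -(ler_nat R) (le_trans (A_le ks))//.
have := f_lip (grid_in01 R (ltnW ks)) (grid_in01 R ks) (grid_le R s (leqnSn k)).
rewrite gridS -/(increment f s k) => H.
rewrite (le_trans (ler_wpM2l (ltW (denom_pos s)) H))// /denom natrM natrM.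
by rewrite mulrCA mulfK// gt_eqF.
Qed.

Lemma height_dist s k l : (k <= l)%N -> (l <= s`!)%N ->
  `|height s l - height s k| <= f (grid R s l) - f (grid R s k).
Proof.
move=> /subnKC <-; elim: (l - k)%N => [|m IH] kms.
  by rewrite addn0 !subrr normr0.
have {IH} := IH (leq_trans (leq_add (leqnn k) (leqnSn m)) kms).
rewrite addnS in kms *.
have : `|height s (k + m).+1 - height s (k + m)| <= increment f s (k + m).
  rewrite /height -mulrBl normrM normfV (gtr0_norm (denom_pos s)).
  rewrite ler_pdivrMr// mulrC (le_trans _ (A_le kms))//.
  by have [p1 p2] := path_step_le A kms; exact: ler_dist_nat.
have := ler_distD (height s (k + m)) (height s (k + m).+1) (height s k).
by rewrite /increment; lra.
Qed.

(** Level 0 is excluded because the path there is constantly 0. *)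
Lemma height_increment s k : (k < s.+1`!)%N ->
  `|height s.+1 k.+1 - height s.+1 k| = (A s.+1 k)%:R / (denom s.+1)%:R.
Proof.
move=> ks; rewrite /height -mulrBl normrM normfV (gtr0_norm (denom_pos _)).
congr (_ / _); have [->|->] := path_step_exact A ks; rewrite natrD.
  by rewrite addrAC subrr add0r ger0_norm.
by rewrite distrC addrAC subrr add0r ger0_norm.
Qed.

(** The tracking error [2 * h] with [h = M * 2 ^ s.+1], divided by [denom s.+1]. *)
Lemma height_refine s i : (i <= s`!)%N ->
  `|height s.+1 (i * s.+1) - height s i| <= 2 * M%:R / s.+1`!%:R.
Proof.
move=> is_; have [T1 T2] := path_track (@A_bound s.+1) (@A_sum s) is_.
have -> : height s i = (2 * s.+1 * path_at A s i)%:R / (denom s.+1)%:R.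
  rewrite /height denomS (natrM _ (2 * s.+1)) (natrM _ (2 * s.+1)).
  by rewrite -mulf_div divff ?mul1r// pnatr_eq0.
rewrite /height -mulrBl normrM normfV (gtr0_norm (denom_pos _)).
rewrite ler_pdivrMr//.
have -> : 2 * M%:R / s.+1`!%:R * (denom s.+1)%:R = (2 * (M * 2 ^ s.+1))%:R :> R.
  rewrite /denom natrM (natrM _ 2) (natrM _ M).
  have : s.+1`!%:R != 0 :> R by rewrite gt_eqF.
  by move: (s.+1`!%:R) (2 ^ s.+1)%:R => x y x0; field.
exact: ler_dist_nat.
Qed.

(** * Grid cells and convergence of the paths *)

Definition cell s (x : R) := Num.truncn (x * s`!%:R).

Lemma cell_grid_le s x : 0 <= x -> grid R s (cell s x) <= x.
Proof.
move=> x0; rewrite /grid ler_pdivrMr// truncn_le mulr_ge0//.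
Qed.

Lemma cell_grid_gt s x : x < grid R s (cell s x).+1.
Proof. by rewrite /grid ltr_pdivlMr// truncnS_gt. Qed.

Lemma cell_le s x : 0 <= x <= 1 -> (cell s x <= s`!)%N.
Proof.
by move=> /andP[x0 x1]; rewrite truncn_le_nat -natr1 ltr_pwDr// ger_pMl.
Qed.

Lemma cell_mono s x y : x <= y -> (cell s x <= cell s y)%N.
Proof. by move=> xy; apply: le_truncn; rewrite ler_pM2r. Qed.

Lemma cell_grid s k : cell s (grid R s k) = k.
Proof. by rewrite /cell /grid divfK ?gt_eqF// natrK. Qed.

Lemma cell_refine s x : 0 <= x -> (cell s x * s.+1 <= cell s.+1 x)%N.
Proof.
move=> x0; rewrite truncn_ge_nat; last by rewrite mulr_ge0// ltW.
rewrite factS (natrM _ (cell s x)) (natrM _ s.+1) (mulrCA x).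
rewrite (mulrC (cell s x)%:R) ler_pM2l ?ltr0n//.
by have := cell_grid_le s x0; rewrite /grid ler_pdivrMr.
Qed.

(** Pass through the finer path at the coarser grid point: refinement costs at most 2 M / s!, and
    moving inside the cell at most M / s!. Then 2 ^ s <= 2 s! turns 3 into 6. *)
Lemma height_cauchy s x : 0 <= x <= 1 ->
  `|height s.+1 (cell s.+1 x) - height s (cell s x)| <= 6 * M%:R / 2 ^+ s.
Proof.
move=> x01; have /andP[x0 x1] := x01.
have cs := cell_le s x01; have cs1 := cell_le s.+1 x01.
have cr := cell_refine s x0.
have H1 := height_refine cs; have H2 := height_dist cr cs1.
have E : (s.+1`! = s.+1 * s`!)%N by rewrite factS.
rewrite (grid_refine R _ E) in H2.
have := f_lip (grid_in01 R cs) (grid_in01 R cs1).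
have g1 := cell_grid_le s.+1 x0; have g2 := cell_grid_gt s x.
have g3 : grid R s (cell s x) <= grid R s.+1 (cell s.+1 x).
  by rewrite -(grid_refine R _ E) grid_le.
move=> /(_ g3) H3.
have H4 : M%:R * (grid R s.+1 (cell s.+1 x) - grid R s (cell s x)) <=
    M%:R / s`!%:R.
  rewrite ler_wpM2l// -(gridS s (cell s x)); lra.
have H5 : 2 * M%:R / s.+1`!%:R <= 2 * M%:R / s`!%:R :> R.
  rewrite ler_wpM2l ?mulr_ge0// lef_pV2 ?posrE// ler_nat.
  by rewrite factS leq_pmull.
have H6 : 3 * (M%:R / s`!%:R) <= 6 * M%:R / 2 ^+ s :> R.
  rewrite mulrA ler_pdivrMr// mulrAC ler_pdivlMr ?exprn_gt0//.
  have := ler_wpM2l (_ : 0 <= 3 * M%:R) (exp_le_fact s).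
  by rewrite mulr_ge0//; lra.
have := ler_distD (height s.+1 (cell s x * s.+1)) (height s.+1 (cell s.+1 x))
  (height s (cell s x)).
lra.
Qed.

Lemma limit_exists : exists g : R -> R, forall x, 0 <= x <= 1 ->
  forall s, `|height s (cell s x) - g x| <= 12 * M%:R / 2 ^+ s.
Proof.
suff /choice[g gP] : forall x, exists l : R, 0 <= x <= 1 ->
    forall s, `|height s (cell s x) - l| <= 12 * M%:R / 2 ^+ s by exists g.
move=> x; have [x01|] := boolP (0 <= x <= 1); last by exists 0.
have [l lP] := geometric_limit (fun s => height_cauchy s x01).
exists l => _ s; have := lP s; rewrite mulrA.
by rewrite (_ : 2 * 6 = 12 :> R)//; ring.
Qed.

Variable g : R -> R.
Hypothesis g_lim : forall x, 0 <= x <= 1 ->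
  forall s, `|height s (cell s x) - g x| <= 12 * M%:R / 2 ^+ s.

Lemma limit_increment x y : 0 <= x -> x <= y -> y <= 1 ->
  `|g y - g x| <= f y - f x.
Proof.
move=> x0 xy y1; have y0 := le_trans x0 xy; have x1 := le_trans xy y1.
have x01 : 0 <= x <= 1 by rewrite x0.
have y01 : 0 <= y <= 1 by rewrite y0.
(* Two approximation errors of 12, plus 2 for replacing [x] by the grid point on its left. At [y]
   monotonicity of [f] suffices. *)
apply: (@le_of_geometric _ _ _ (26 * M%:R)) => s.
have cx := cell_le s x01; have cy := cell_le s y01.
have H1 := height_dist (cell_mono s xy) cy.
have H2 : f (grid R s (cell s y)) <= f y.
  by apply: f_nd; rewrite ?grid_in01 ?cell_grid_le// in_itv/= y0.
have H3 := f_lip (grid_in01 R cx) (_ : x \in `[0, 1]) (cell_grid_le s x0).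
have {}H3 := H3 (introT andP (conj x0 x1)).
have H4 : M%:R * (x - grid R s (cell s x)) <= 2 * M%:R / 2 ^+ s.
  have : x - grid R s (cell s x) <= 2 / 2 ^+ s.
    have : s`!%:R^-1 <= 2 / 2 ^+ s :> R.
      by rewrite ler_pdivlMr ?exprn_gt0// mulrC ler_pdivrMr// exp_le_fact.
    by rewrite -(gridS s (cell s x)); have := cell_grid_gt s x; lra.
  by move=> /(ler_wpM2l (ler0n _ M)); rewrite mulrA (mulrC _ 2).
have H5 := g_lim x01 s; have H6 := g_lim y01 s.
have D1 := ler_distD (height s (cell s x)) (g y) (g x).
have D2 := ler_distD (height s (cell s y)) (g y) (height s (cell s x)).
rewrite (distrC (g y) (height s (cell s y))) in D2.
have -> : 26 * M%:R / 2 ^+ s = 12 * M%:R / 2 ^+ s + 12 * M%:R / 2 ^+ s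
   + 2 * M%:R / 2 ^+ s :> R by rewrite -!mulrDl; congr (_ / _); ring.
lra.
Qed.

(** A grid point remains one at all finer levels, so only the errors of [height_refine] accumulate,
    and they at least halve from level to level. Unlike the general rate, this bound stays small
    after summation over s! intervals. *)
Lemma limit_grid s k : (k <= s`!)%N ->
  `|height s k - g (grid R s k)| <= 4 * M%:R / s.+1`!%:R.
Proof.
move=> ks; set x := grid R s k.
have x01 : 0 <= x <= 1 by have := grid_in01 R ks; rewrite in_itv.
pose a n := height (s + n) (cell (s + n) x).
have -> : height s k = a 0%N by rewrite /a addn0 cell_grid.
have -> : 4 * M%:R / s.+1`!%:R = 2 * (2 * M%:R / s.+1`!%:R) :> R.
  by rewrite mulrA mulrA; congr (_ * _ / _); ring.
apply: (@limit_dist _ _ _ (12 * M%:R / 2 ^+ s)) => n; last first.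
  by rewrite /a (le_trans (g_lim x01 _))// exprD invfM mulrA.
have gx m : exists2 j, (j <= (s + m)`!)%N & x = grid R (s + m) j.
  exists (k * ((s + m)`! %/ s`!))%N.
    by rewrite -[leqRHS](fact_divK (leq_addr m s)) mulnC leq_mul2l ks orbT.
  by rewrite (@grid_refine _ s)// fact_divK// leq_addr.
have [j js xj] := gx n.
have E : ((s + n).+1`! = (s + n).+1 * (s + n)`!)%N by rewrite factS.
rewrite /a addnS {1}xj -(grid_refine R j E) xj !cell_grid.
rewrite (le_trans (height_refine js))// -[leRHS]mulrA -invfM.
rewrite ler_wpM2l ?mulr_ge0// lef_pV2 ?posrE ?mulr_gt0 ?exprn_gt0//.
rewrite -natrX -natrM ler_nat; elim: n {js xj E j} => [|n IH].
  by rewrite addn0 muln1.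
rewrite addnS [leqRHS]factS expnS mulnCA leq_mul//.
Qed.

(** * Variation of the limit *)

Lemma total_variation_ge_grid s k : (k <= s`!)%N ->
  ((\sum_(i < k) `|g (grid R s i.+1) - g (grid R s i)|)%:E <=
   total_variation 0 (grid R s k) g)%E.
Proof.
elim: k => [|k IH] ks.
  by rewrite big_ord0 total_variation_ge0 ?grid_ge0.
rewrite (total_variationD g (grid_ge0 R s k) (grid_le R s (leqnSn k))).
rewrite big_ord_recr/= EFinD leeD ?IH ?total_variation_ge ?grid_le//.
exact: ltnW.
Qed.

Lemma total_variation_limit_ge : ((f 1)%:E <= total_variation 0 1 g)%E.
Proof.
apply/lee_addgt0Pr => e e0; rewrite -leeBlDr// -EFinB.
have e20 : 0 < e / 2 by rewrite divr_gt0.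
have [s0 H0] := A_lim e20.
(* At level [s.+1] each interval loses 4 M / (s + 2)! at both ends; over (s + 1)! intervals this is
   8 M / (s + 2), at most [e / 2]. *)
pose s := maxn s0 (Num.bound (8 * M%:R / (e / 2))).
have := total_variation_ge_grid (leqnn s.+1`!); rewrite grid_top.
apply: le_trans; rewrite lee_fin.
have step i : (i < s.+1`!)%N ->
    (A s.+1 i)%:R / (denom s.+1)%:R - 8 * M%:R / s.+2`!%:R <=
    `|g (grid R s.+1 i.+1) - g (grid R s.+1 i)|.
  move=> is_; rewrite -(height_increment is_).
  have L1 := limit_grid is_; have L2 := limit_grid (ltnW is_).
  have D1 := ler_distD (g (grid R s.+1 i.+1)) (height s.+1 i.+1)
    (height s.+1 i).
  have D2 := ler_distD (g (grid R s.+1 i)) (g (grid R s.+1 i.+1))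
    (height s.+1 i).
  rewrite (distrC (g (grid R s.+1 i)) (height _ _)) in D2.
  have -> : 8 * M%:R / s.+2`!%:R =
      4 * M%:R / s.+2`!%:R + 4 * M%:R / s.+2`!%:R :> R.
    by rewrite -mulrDl; congr (_ / _); ring.
  lra.
have : \sum_(i < s.+1`!)
      ((A s.+1 i)%:R / (denom s.+1)%:R - 8 * M%:R / s.+2`!%:R) <=
    \sum_(i < s.+1`!) `|g (grid R s.+1 i.+1) - g (grid R s.+1 i)|.
  by apply: ler_sum => -[i /= is_] _; exact: step.
apply: le_trans; rewrite sumrB -mulr_suml -natr_sum sumr_const card_ord.
have := H0 s.+1 (leq_trans (leq_maxl _ _) (leqnSn s)).
suff : (8 * M%:R / s.+2`!%:R) *+ s.+1`! <= e / 2 by lra.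
rewrite -mulr_natr [s.+2`!]factS natrM invfM mulrA mulfVK ?gt_eqF//.
rewrite ler_pdivrMr ?ltr0n// (mulrC (e / 2)) -ler_pdivrMr//.
have b0 : 0 <= 8 * M%:R / (e / 2) by rewrite divr_ge0// ?mulr_ge0// ltW.
rewrite (le_trans (ltW (archi_boundP b0)))// ler_nat.
by rewrite (leq_trans (leq_maxr s0 _))// /s leqW// leqW.
Qed.

Lemma total_variation_limit_le x y : 0 <= x -> x <= y -> y <= 1 ->
  (total_variation x y g <= (f y - f x)%:E)%E.
Proof.
move=> x0 xy y1.
have fxy : {in `[x, y] &, nondecreasing_fun f}.
  by move=> a b; rewrite !in_itv/= => /andP[xa ay] /andP[xb b_y] ab;
    apply: f_nd => //; rewrite in_itv/= (le_trans x0)// (le_trans _ y1).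
apply: ge_ereal_sup => _ [_ [l xyl <-] <-].
(* The bound is itself the variation of [f] along the same partition, which allows a termwise
   comparison. *)
rewrite lee_fin -(nondecreasing_variation fxy xyl) /variation !big_nat.
apply: ler_sum => n /= nl; have lp := (pathP y xyl.1 n nl).
have n1 := itv_partition_nth_ge (ltnW nl : n < (size l).+1)%N xyl.
have n2 := itv_partition_nth_le (nl : n.+1 < (size l).+1)%N xyl.
apply: (le_trans (limit_increment _ (ltW lp) _)); last exact: ler_norm.
  exact: le_trans n1.
exact: le_trans y1.
Qed.

Lemma total_variation_limit x : 0 <= x <= 1 ->
  total_variation 0 x g = (f x)%:E.
Proof.
move=> /andP[x0 x1].
have L1 := total_variation_limit_le (lexx 0) x0 x1.
have L2 := total_variation_limit_le x0 x1 (lexx 1).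
have := total_variation_limit_ge; rewrite (total_variationD g x0 x1).
have V1 := total_variation_ge0 g x0; have V2 := total_variation_ge0 g x1.
move: L1 L2 V1 V2; rewrite f0 subr0.
case: (total_variation 0 x g) => [u| |]//.
case: (total_variation x 1 g) => [v| |]//.
rewrite -EFinD !lee_fin => L1 L2 _ _ L3; congr EFin; lra.
Qed.

End LimitFunction.

(** * Computability of the limit, and the conclusion *)

Lemma truncn_divn (R : realType) m d : (0 < d)%N ->
  Num.truncn (m%:R / d%:R : R) = (m %/ d)%N.
Proof.
move=> d0; apply: truncn_def; rewrite ler_pdivlMr ?ltr0n// ltr_pdivrMr ?ltr0n//.
by rewrite -!natrM ler_nat ltr_nat leq_divM ltn_ceil.
Qed.

(* The numerator of a code of a non-negative rational is a difference of natural
   numbers that truncated subtraction computes correctly. *)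
Lemma cell_rat_of_code (R : realType) s n : 0 <= rat_of_code n ->
  cell s (ratr (rat_of_code n) : R) =
  ((logn 2 n - logn 3 n) * s`! %/ (logn 5 n).+1)%N.
Proof.
rewrite /rat_of_code pmulr_lge0 ?invr_gt0 ?ltr0n// subr_ge0 ler_nat => ba.
rewrite /cell -natrB// fmorph_div/= !ratr_nat mulrAC -natrM.
exact: truncn_divn.
Qed.

(** The cell of a rational is found exactly by integer division on its code, so the approximation is
    a single path value at a level known in advance. *)
Lemma limit_computable (R : realType) (A : nat -> nat -> nat) (b : nat)
    (g : R -> R) :
  envrec 2 (fun e => A (e 0%N) (e 1%N)) ->
  (forall x : R, 0 <= x <= 1 ->
    forall s, `|height A s (cell s x) - g x| <= b%:R / 2 ^+ s) ->
  uniformly_computable [set p : 1.-tuple rat | 0 <= p`_0 <= 1]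
    (fun p => g (ratr p`_0)).
Proof.
move=> rA gl; have rp := envrec_path_at rA.
have r2 := envrec_ratcode; have r1 := envrec_denom.
pose F s n := ratcode
  (path_at A s ((logn 2 n - logn 3 n) * s`! %/ (logn 5 n).+1)) (denom s).
(* Level [n + b] gives precision [2 ^- n], because [b < 2 ^ b]. *)
have rF : envrec 2 (fun e => F (e 0%N + b)%N (e 1%N)).
  by rewrite /F; envrec_tac.
exists (fun v => F (nth 0%N v 0 + b)%N (nth 0%N v 1)) => // v.
case: (tupleP v) => c w; rewrite [w]tuple0 /= => Dv n.
have Dn : (0 < denom (n + b))%N by rewrite muln_gt0 expn_gt0 fact_gt0.
have /andP[c0 c1] := Dv.
rewrite /F rat_of_ratcode// -(cell_rat_of_code R _ c0).
have x01 : 0 <= (ratr (rat_of_code c) : R) <= 1.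
  by rewrite ler0q c0 -(rmorph1 (@ratr R)) ler_rat.
rewrite fmorph_div/= !ratr_nat (le_trans (gl _ x01 _))//.
rewrite exprD invfM mulrA mulrAC ger_pMl ?invr_gt0 ?exprn_gt0//.
by rewrite ler_pdivrMr ?exprn_gt0// mul1r -natrX ler_nat ltnW// ltn_expl.
Qed.

Theorem theorem3p4 (R : realType) (f : R -> R) (c : R)
    (f_nondecreasing : {in `[0, 1] &, nondecreasing_fun f})
    (f_interval_re : interval_re f)
    (f_lipschitz : c.-lipschitz_(`[0, 1]) f) :
  exists g : R -> R,
    [/\ computable_fun g,
        c.-lipschitz_(`[0, 1]) g &
        {in `[0, 1], forall x : R, (f x)%:E = total_variation 0 x g}].
Proof.
have f0 := f_interval_re.1.
have f_lip x y : x \in `[0, 1] -> y \in `[0, 1] -> `|f x - f y| <= c * `|x - y|.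
  by move=> x01 y01; exact: (f_lipschitz (x, y) (conj x01 y01)).
(* A natural bound serves for the error rates and the modulus of continuity; the constant [c] itself
   passes to [g] through [g_dist]. *)
pose M := Num.bound `|c|.
have cM : c <= M%:R.
  by rewrite (le_trans (ler_norm c))// ltW// archi_boundP.
have f_lipM :
    {in `[0, 1] &, forall x y : R, x <= y -> f y - f x <= M%:R * (y - x)}.
  move=> x y x01 y01 xy; rewrite (le_trans (ler_norm _))//.
  rewrite (le_trans (f_lip _ _ y01 x01))// ger0_norm ?subr_ge0//.
  by rewrite ler_wpM2r// subr_ge0.
have [A [rA A_le A_sum A_lim]] := computable_increments f_interval_re.
have {}A_le s k := @A_le s k f_nondecreasing.
have [g g_lim] := limit_exists f_lipM A_le A_sum.
have g_inc := limit_increment f_nondecreasing f_lipM A_le g_lim.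
have g_dist x y : x \in `[0, 1] -> y \in `[0, 1] ->
    `|g x - g y| <= `|f x - f y|.
  wlog xy : x y / y <= x => [H x01 y01|].
    have [yx|/ltW xy] := leP y x; first exact: H.
    by rewrite distrC (distrC (f x)); exact: H.
  rewrite !in_itv/= => /andP[x0 x1] /andP[y0 y1].
  by rewrite (le_trans (g_inc _ _ y0 xy x1))// ler_norm.
exists g; split; last first.
- move=> x; rewrite in_itv/= => x01; apply/esym.
  exact: (total_variation_limit f0 f_nondecreasing f_lipM A_le A_sum A_lim).
- by move=> [x y] [/= x01 y01]; rewrite (le_trans (g_dist _ _ x01 y01))// f_lip.
split; first by apply: (limit_computable (b := 12 * M) rA); rewrite natrM.
(* This is a modulus because [c <= M < 2 ^ M]. *)
exists (fun n => n + M)%N.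
  suff : envrec 1 (fun e => e 0%N + M)%N.
    by apply: recursive_ext => v; rewrite /thead (tnth_nth 0%N).
  by envrec_tac.
move=> n x y x01 y01 xy; apply: le_lt_trans (g_dist _ _ x01 y01) _.
apply: le_lt_trans (f_lip _ _ x01 y01) _.
apply: (@le_lt_trans _ _ (2 ^+ M * `|x - y|)).
  rewrite ler_wpM2r// (le_trans cM)// -natrX ler_nat ltnW//; exact: ltn_expl.
by rewrite mulrC -ltr_pdivlMr ?exprn_gt0// -invfM -exprD.
Qed.
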